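(* Let $K,q,M,n$ be positive integers with $q>K$ and $M\ge K$. Let $\mathbf{A}=(A_1,\dots,A_K)$ be a multinomially distributed random vector with $n$ trials and $K$ possible outcomes having probabilities $$p_k=\frac{q!\,S(K,k)}{(q-k)!\,q^K},\qquad k=1,\dots,K,$$ where $S(K,k)$ denotes the Stirling number of the second kind. (i) There exists an $(M,n,\epsilon)$-code for the unsourced $K$-user $q$-ary A-channel, with respect to the per-user probability of error, with $\epsilon$ satisfying $$\epsilon\le \sum_{\ell=1}^{K-1}\frac{\ell}{K+\ell}\,\mathbb{E}\left[\min\left\{1,\binom{M-K}{\ell}\prod_{k=1}^{K}\left(\frac{k}{q}\right)^{A_k\ell}\right\}\right]+\mathbb{E}\left[\min\left\{1,\binom{M-K}{K}\prod_{k=1}^{K}\left(\frac{k}{q}\right)^{A_kK}\right\}\right]+\frac{\binom{K}{2}}{M}.$$ (ii) There exists an $(M,n,\epsilon)$-code for the unsourced $K$-user $q$-ary A-channel, with respect to the joint probability of error, with $\epsilon$ satisfying $$\epsilon\le \frac{\binom{K}{2}}{M}+\mathbb{E}\left[\min\left\{1,(M-K)\prod_{k=1}^{K}\left(\frac{k}{q}\right)^{A_k}\right\}\right].$$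
   Context: Notation: $[a]=\{1,\dots,a\}$, and $\binom{[a]}{b}$ denotes the set of $b$-element subsets of $[a]$. The $K$-user $q$-ary A-channel: at each channel use $i\in[n]$, user $j\in[K]$ sends a symbol $c_{i,j}\in[q]$ and the receiver observes the set $Y_i=\bigcup_{j=1}^K\{c_{i,j}\}$ of distinct transmitted symbols (without multiplicities or sender identities). Write $\mathbf{Y}=(Y_1,\dots,Y_n)$. Unsourced code: assume $q>K$. An $(M,n,\epsilon)$-code for the unsourced $K$-user A-channel consists of an encoder $f:[M]\to[q]^n$, common to all users, and a decoder $g:\left(\bigcup_{k=1}^{K}\binom{[q]}{k}\right)^n\to\binom{[M]}{K}$. The messages $W_1,\dots,W_K$ are independent and uniformly distributed on $[M]$, user $j$ transmits the codeword $f(W_j)=(c_{1,j},\dots,c_{n,j})$, and $\mathbf{Y}$ is the resulting channel output. The code is an $(M,n,\epsilon)$-code with respect to the per-user probability of error if $$P_{\mathrm e}^{(\mathrm p)}=\mathbb{P}\big[\{W_j\notin g(\mathbf{Y})\}\cup\{W_j=W_i\text{ for some }i\ne j\}\big]\le\epsilon$$ (by symmetry this probability does not depend on $j\in[K]$). It is an $(M,n,\epsilon)$-code with respect to the joint probability of error if $$P_{\mathrm e}^{(\mathrm j)}=\mathbb{P}\big[\{\{W_1,\dots,W_K\}\ne g(\mathbf{Y})\}\cup\{W_j=W_i\text{ for some }i\ne j\}\big]\le\epsilon.$$ *)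

(* Defs.v *)
From HB Require Import structures.
From mathcomp Require Import all_boot all_order all_algebra.
From mathcomp Require Import all_classical all_reals all_analysis.

Set Implicit Arguments.
Unset Strict Implicit.
Unset Printing Implicit Defensive.

Import Order.TTheory GRing.Theory Num.Theory.

Local Open Scope classical_set_scope.
Local Open Scope ring_scope.

(* The alphabet [q], the messages [M], the users [K] and the channel uses [n]
   are the ordinals 'I_q, 'I_M, 'I_K, 'I_n; they are numbered from 0. *)

Definition out_symbol (K q : nat) : Type :=
  {S : {set 'I_q} | (0 < #|S| <= K)%N}.

Definition message_subset (M K : nat) : Type := {B : {set 'I_M} | #|B| == K}.

Definition encoder (q M n : nat) : Type := 'I_M -> {ffun 'I_n -> 'I_q}.

Definition decoder (K q M n : nat) : Type :=
  {ffun 'I_n -> out_symbol K q} -> message_subset M K.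

Definition union_symbols (K q : nat) (c : 'I_K -> 'I_q) : {set 'I_q} :=
  (\bigcup_(j < K) [set c j])%SET.

Lemma union_symbolsP (K q : nat) (c : 'I_K -> 'I_q) :
  (0 < K)%N -> (0 < #|union_symbols c| <= K)%N.
Proof.
move=> K_gt0; apply/andP; split.
  apply/card_gt0P; exists (c (Ordinal K_gt0)); apply/bigcupP.
  by exists (Ordinal K_gt0); rewrite ?inE.
have -> : union_symbols c = [set c j | j : 'I_K]%SET.
  apply/setP => x; apply/bigcupP/imsetP => [[j _ /set1P ->]|[j _ ->]].
    by exists j.
  by exists j; rewrite ?inE.
by rewrite -[leqRHS]card_ord leq_imset_card.
Qed.

(* The positivity of K is only used to know that outputs are nonempty sets. *)
Definition channel_output (K q n : nat) (K_gt0 : (0 < K)%N)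
    (c : 'I_K -> {ffun 'I_n -> 'I_q}) : {ffun 'I_n -> out_symbol K q} :=
  [ffun i => exist _ (union_symbols (fun j => c j i))
                     (union_symbolsP (fun j => c j i) K_gt0)].

(* Messages are random variables for the discrete sigma-algebra on 'I_M.
   Taking some of the B j to be setT in the product rule gives it for every
   subfamily. *)
Definition independent_uniform (R : realType) (K M : nat) (d : measure_display)
    (Omega : measurableType d) (P : probability Omega R)
    (W : 'I_K -> Omega -> 'I_M) : Prop :=
  [/\ forall (j : 'I_K) (B : set 'I_M), measurable (W j @^-1` B),
      forall B : 'I_K -> set 'I_M,
        P [set t | forall j, B j (W j t)] =
          (\prod_(j < K) P (W j @^-1` B j))%E
    & forall (j : 'I_K) (m : 'I_M), P (W j @^-1` [set m]) = (M%:R^-1)%:E].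

Section ErrorEvents.
Variables (K q M n : nat) (K_gt0 : (0 < K)%N).
Variables (f : encoder q M n) (g : decoder K q M n).
Variables (Omega : Type) (W : 'I_K -> Omega -> 'I_M).

Definition decoded (t : Omega) : {set 'I_M} :=
  val (g (channel_output K_gt0 (fun j => f (W j t)))).

(* In the per-user event the user j is fixed and collisions are collisions
   with user j; in the joint event any two users may collide. *)
Definition per_user_error (j : 'I_K) : set Omega :=
  [set t | W j t \notin decoded t] `|`
  [set t | exists2 i : 'I_K, i != j & W j t = W i t].

Definition joint_error : set Omega :=
  [set t | [set W j t | j : 'I_K]%SET <> decoded t] `|`
  [set t | exists i j : 'I_K, i != j /\ W j t = W i t].

End ErrorEvents.

(* The error probabilities depend only on the joint law of the messages, so
   they are constrained on every probability space carrying such messages. *)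
Definition per_user_code (R : realType) (K q M n : nat) (K_gt0 : (0 < K)%N)
    (eps : R) (f : encoder q M n) (g : decoder K q M n) : Prop :=
  forall (d : measure_display) (Omega : measurableType d)
         (P : probability Omega R) (W : 'I_K -> Omega -> 'I_M),
    independent_uniform P W ->
    forall j : 'I_K, (P (per_user_error K_gt0 f g W j) <= eps%:E)%E.

Definition joint_code (R : realType) (K q M n : nat) (K_gt0 : (0 < K)%N)
    (eps : R) (f : encoder q M n) (g : decoder K q M n) : Prop :=
  forall (d : measure_display) (Omega : measurableType d)
         (P : probability Omega R) (W : 'I_K -> Omega -> 'I_M),
    independent_uniform P W ->
    (P (joint_error K_gt0 f g W) <= eps%:E)%E.

Definition stirling2 (m k : nat) : nat :=
  #|[set X : {set {set 'I_m}} |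
      finset.partition X [set: 'I_m] & #|X| == k]%SET|.

Definition out_size_prob (R : realType) (K q k : nat) : R :=
  (q`! * stirling2 K k)%:R / ((q - k)`!%:R * q%:R ^+ K).

Definition multinomial_pmf (R : realType) (m n : nat) (p : 'I_m -> R)
    (a : 'I_m -> nat) : R :=
  if (\sum_(k < m) a k)%N == n
  then n`!%:R / (\prod_(k < m) (a k)`!%:R) * \prod_(k < m) p k ^+ a k
  else 0.

Definition multinomially_distributed (R : realType) (m n : nat) (p : 'I_m -> R)
    (d : measure_display) (T : measurableType d) (P : probability T R)
    (A : 'I_m -> {RV P >-> nat}) : Prop :=
  forall a : 'I_m -> nat,
    P [set t | forall k, A k t = a k] = (multinomial_pmf n p a)%:E.

(* Main.v *)
Require Import Defs.
From HB Require Import structures.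
From mathcomp Require Import all_boot all_order all_algebra.
From mathcomp Require Import perm ring zify.
From mathcomp Require Import all_classical all_reals all_analysis.
From mathcomp Require Import measurable_realfun.

(** Random coding with the codebook uniform over all [f : [M] -> [q]^n].
    Given distinct messages, the [K] transmitted words are independent and
    uniform, so the output sizes [|Y_i|] are independent with law [p_k] and
    their counts are multinomial.  Given the output, each other codeword is
    compatible with it with probability [prod_i |Y_i| / q]; a union bound over
    the sets of [l] other messages controls the event of having at least [l]
    false positives.  In the per-user setting, the receiver outputs [K] of the
    [K + l] candidates: a uniformly random choice misses a given transmitted
    message with probability [l / (K + l)], and a deterministic choice doing at
    least as well is made separately for each output.  In the joint setting the
    decoder succeeds as soon as there is no false positive.  Colliding messages
    cost [C(K, 2) / M], and some codebook is at least as good as the mean. *)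

Set Implicit Arguments.
Unset Strict Implicit.
Unset Printing Implicit Defensive.

Import Order.TTheory GRing.Theory Num.Theory.

Local Open Scope ring_scope.

(** * Counting functions by image size and by occurrences *)

(** The blocks are the fibres over the image, and nonempty fibres over distinct values are
    distinct. *)
Lemma card_preim_partition (aT rT : finType) (c : {ffun aT -> rT}) :
  #|preim_partition c [set: aT]%SET| = #|(c @: [set: aT])%SET|.
Proof.
have -> : (preim_partition c [set: aT] =
           (fun y => c @^-1: [set y]) @: (c @: [set: aT]))%SET.
  rewrite -imset_comp; apply: eq_imset => x /=.
  by apply/setP => y; rewrite !inE eq_sym.
apply: card_in_imset => _ _ /imsetP[x _ ->] /imsetP[y _ ->] /setP/(_ x).
by rewrite !inE eqxx => /esym/eqP.
Qed.

(** A map whose fibres are the blocks of [X] factors uniquely through the block map [pb], by an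
    injection from blocks to [rT]. The representatives [e] recover this injection from the map. *)
Lemma card_ffun_preim_partition (aT rT : finType) (X : {set {set aT}}) :
  finset.partition X [set: aT]%SET ->
  #|[set c : {ffun aT -> rT} | preim_partition c [set: aT]%SET == X]%SET|
    = (#|rT| ^_ #|X|)%N.
Proof.
move=> partX; have [/eqP covX tiX X0] := and3P partX.
have cov x : x \in finset.cover X by rewrite covX inE.
pose D := {B : {set aT} | B \in X}.
pose pb x : D := exist _ (finset.pblock X x) (pblock_mem (cov x)).
have /fin_all_exists[e eP] (B : D) : exists x, x \in val B.
  by apply/set0Pn; apply: contraNneq X0 => <-; exact: valP.
have pbe B : pb (e B) = B by apply/val_inj/(def_pblock tiX (valP B) (eP B)).
pose Phi (g : {ffun D -> rT}) : {ffun aT -> rT} := [ffun x => g (pb x)].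
have Phi_inj : injective Phi.
  by move=> g h /ffunP gh; apply/ffunP => B; have := gh (e B); rewrite !ffunE pbe.
have -> : #|X| = #|{: D}| by rewrite card_sig; apply: eq_card => B; rewrite !inE.
rewrite -card_inj_ffuns -(card_imset _ Phi_inj); apply: eq_card => c; rewrite inE.
apply/eqP/imsetP => [cX|[g]].
  have pbP x y : (y \in finset.pblock X x) = (c x == c y).
    rewrite -cX pblock_equivalence_partition ?inE//.
    by split=> // /eqP->.
  exists [ffun B => c (e B)]; last first.
    apply/ffunP => x; rewrite !ffunE; apply/eqP.
    by rewrite -pbP; exact: (eP (pb x)).
  rewrite inE; apply/injectiveP => B B'; rewrite !ffunE => /eqP.
  rewrite -pbP => eB'; rewrite -(pbe B) -(pbe B'); apply: val_inj => /=.
  by apply/esym/same_pblock.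
rewrite inE => /injectiveP ginj ->; rewrite -[RHS](preim_partition_pblock partX).
apply: eq_in_imset => x _; apply/setP => y.
rewrite !inE !ffunE (inj_eq ginj) -val_eqE /=.
by rewrite eq_pblock.
Qed.

(** Maps are grouped by their fibre partition. The right-hand side is where the Stirling number in
    [out_size_prob] comes from. *)
Lemma card_ffun_card_imset (aT rT : finType) (k : nat) :
  #|[set c : {ffun aT -> rT} | #|(c @: [set: aT])%SET| == k]%SET|
    = (#|rT| ^_ k * #|[set X | finset.partition X [set: aT] & #|X| == k]%SET|)%N.
Proof.
rewrite mulnC -sum_nat_cond_const -sum1dep_card.
rewrite (partition_big
  (fun c : {ffun aT -> rT} => preim_partition c [set: aT]%SET)
  (fun X => finset.partition X [set: aT]%SET && (#|X| == k))) /=; last first.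
  by move=> c; rewrite preim_partitionP card_preim_partition.
apply: eq_bigr => X /andP[partX /eqP cX].
rewrite -cX -card_ffun_preim_partition// -sum1dep_card; apply: eq_bigl => c.
by rewrite -card_preim_partition andbC; case: eqP => // ->; rewrite eqxx.
Qed.

Definition occ (I : finType) (n : nat) (s : 'I_n -> I) (k : I) : nat :=
  \sum_(i < n) (s i == k)%N.

Lemma sum_occ (I : finType) (n : nat) (s : 'I_n -> I) : (\sum_k occ s k = n)%N.
Proof.
rewrite exchange_big /= -[RHS]card_ord -sum1_card; apply: eq_bigr => i _.
by rewrite (bigD1 (s i))//= eqxx big1// => k /negPf; rewrite eq_sym => ->.
Qed.

(** This is the multinomial coefficient, stated without division. Induction on [n]: sequences are
    split by their first letter [k], whose removal lowers [a k] by one; each [k] contributes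
    [a k * n!]. *)
Lemma card_occ (I : finType) (n : nat) (a : I -> nat) : (\sum_k a k = n)%N ->
  (#|[set s : {ffun 'I_n -> I} | [forall k, occ s k == a k]]%SET| *
   \prod_k (a k)`! = n`!)%N.
Proof.
elim: n a => [|n IHn] a sum_a.
  have a0 k : a k = 0%N.
    by apply/eqP; move/eqP: sum_a; rewrite sum_nat_eq0 => /forallP/(_ k).
  rewrite [X in (_ * X)%N]big1 ?muln1 => [|k _]; last by rewrite a0.
  have -> : [set s : {ffun 'I_0 -> I} | [forall k, occ s k == a k]]%SET = [set: _]%SET.
    by apply/setP => s; rewrite !inE; apply/forallP => k; rewrite /occ big_ord0 a0.
  by rewrite cardsT card_ffun card_ord expn0.
pose dec k k' := (a k' - (k == k'))%N.
pose ext k (s : {ffun 'I_n -> I}) : {ffun 'I_n.+1 -> I} :=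
  [ffun i => oapp s k (unlift ord0 i)].
have occ_ext k s k' : occ (ext k s) k' = ((k == k') + occ s k')%N.
  rewrite /occ big_ord_recl ffunE unlift_none; congr addn.
  by apply: eq_bigr => i _; rewrite ffunE liftK.
rewrite -sum1dep_card (partition_big (fun s : {ffun 'I_n.+1 -> I} => s ord0) predT)//=.
rewrite big_distrl /=.
transitivity (\sum_k a k * n`!)%N; last by rewrite -big_distrl /= sum_a factS.
apply: eq_bigr => k _.
rewrite (reindex_onto (ext k) (fun s => [ffun i => s (lift ord0 i)])) /=; last first.
  move=> s /andP[_ /eqP <-]; apply/ffunP => i; rewrite ffunE.
  by case: unliftP => [j|] ->; rewrite /= ?ffunE.
(* If [a k] is zero, no sequence starts with [k]; this case is set apart because the subtraction in
   [dec] would be truncated. *)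
have [ak0|ak_gt0] := posnP (a k).
  rewrite ak0 mul0n big_pred0 ?mul0n// => s; apply/negP => /andP[/andP[/forallP/(_ k)]].
  by rewrite occ_ext eqxx ak0.
have -> : (\prod_k' (a k')`! = a k * \prod_k' (dec k k')`!)%N.
  rewrite (bigD1 k)//= [in RHS](bigD1 k)//= /dec eqxx subn1 mulnA; congr muln.
    by rewrite -[in LHS](prednK ak_gt0) factS prednK.
  by apply: eq_bigr => k' /negPf; rewrite eq_sym => ->; rewrite subn0.
rewrite mulnCA; congr muln; rewrite -(IHn (dec k)).
  rewrite -sum1dep_card; congr muln; apply: eq_bigl => s.
  rewrite ffunE unlift_none eqxx andbT.
  have -> : [ffun i => ext k s (lift ord0 i)] = s.
    by apply/ffunP => i; rewrite !ffunE liftK.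
  rewrite eqxx andbT; apply: eq_forallb => k'; rewrite occ_ext /dec.
  have [<-|_] := eqVneq k k'; last by rewrite subn0.
  by rewrite -[in LHS](prednK ak_gt0) add1n eqSS subn1.
apply/eqP; rewrite -(eqn_add2l 1) [X in _ == X]add1n -sum_a.
rewrite (bigD1 k)//= [in X in _ == X](bigD1 k)//= addnA /dec eqxx.
rewrite subnKC//; apply/eqP; congr addn; apply: eq_bigr => k' /negPf.
by rewrite eq_sym => ->; rewrite subn0.
Qed.

(** * False positives of a random codebook *)

Lemma card_pred_family (I J : finType) (Q : I -> pred J) :
  (#|[set f : {ffun I -> J} | [forall i, Q i (f i)]]%SET| = \prod_i #|Q i|)%N.
Proof.
rewrite -sum1dep_card.
have -> : (\prod_i #|Q i| = \prod_i \sum_(j | Q i j) 1)%N.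
  by apply: eq_bigr => i _; rewrite sum1_card; apply: eq_card.
rewrite bigA_distr_big_dep; apply: eq_big => [f|f _]; last by rewrite big1.
by apply/forallP/familyP.
Qed.

Section FalsePositives.
Variables (I J X : finType) (w : I -> J) (C : {ffun I -> X} -> {set X}).
Hypothesis w_inj : injective w.

Lemma card_setC_imset : #|(~: (w @: [set: I]))%SET| = (#|J| - #|I|)%N.
Proof. by rewrite cardsCs finset.setCK card_imset// cardsT. Qed.

(** The constraints bear on each message separately: the value is forced on the image of [w],
    confined to [D] on [S], and free elsewhere. *)
Lemma card_extensions (x : {ffun I -> X}) (D : {set X}) (S : {set J}) :
  S \subset (~: (w @: [set: I]))%SET ->
  (#|[set f : {ffun J -> X} | ([ffun i => f (w i)] == x) &&
       [forall m in S, f m \in D]]%SET|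
     = #|D| ^ #|S| * #|X| ^ (#|J| - #|I| - #|S|))%N.
Proof.
move=> SZ; set Z := (w @: [set: I])%SET in SZ.
pose Q m c := [forall i, (w i == m) ==> (c == x i)] && ((m \in S) ==> (c \in D)).
transitivity #|[set f : {ffun J -> X} | [forall m, Q m (f m)]]%SET|.
  apply: eq_card => f; rewrite !inE; apply/andP/forallP => [[/eqP fx /forallP fS] m|fQ].
    apply/andP; split; last exact: fS.
    by apply/forallP => i; apply/implyP => /eqP <-; rewrite -fx ffunE.
  split; last by apply/forallP => m; case/andP: (fQ m).
  apply/eqP/ffunP => i; rewrite ffunE.
  by case/andP: (fQ (w i)) => /forallP/(_ i); rewrite eqxx => /eqP.
rewrite card_pred_family.
have QE m : #|Q m| = if m \in Z then 1%N else if m \in S then #|D| else #|X|.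
  have [/imsetP[i _ ->]|mZ] := ifPn.
    rewrite -(card1 (x i)); apply: eq_card => c; rewrite [RHS]inE unfold_in /Q.
    have -> : w i \in S = false.
      by apply/negP => /(fintype.subsetP SZ); rewrite inE imset_f ?inE.
    rewrite /= andbT; apply/forallP/eqP => [/(_ i)|-> i']; first by rewrite eqxx => /eqP.
    by apply/implyP => /eqP/w_inj ->.
  have Q1 c : [forall i, (w i == m) ==> (c == x i)].
    by apply/forallP => i; apply/implyP => /eqP wm; rewrite -wm imset_f ?inE in mZ.
  by case: ifPn => mS; apply: eq_card => c; rewrite unfold_in /Q Q1 ?(negPf mS) ?mS.
under eq_bigr do rewrite QE.
rewrite (bigID (mem Z))/= [X in (X * _)%N]big1 ?mul1n => [|m ->//].
rewrite (bigID (mem S))/=; congr muln.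
  rewrite -prod_nat_const; apply: eq_big => [m|m /andP[/negPf-> ->//]].
  rewrite andbC; case: (boolP (m \in S)) => //= /(fintype.subsetP SZ).
  by rewrite inE => ->.
rewrite (eq_bigr (fun=> #|X|)) => [|m /andP[/negPf-> /negPf->//]].
rewrite (eq_bigl (mem (~: Z :\: S)%SET)) => [|m]; last by rewrite !inE andbC.
by rewrite prod_nat_const cardsD (finset.setIidPr SZ) card_setC_imset.
Qed.

(** Here [I] stands for the users, [J] for the messages and [X] for the words; [C x] plays the set
    of words compatible with the transmitted family [x]. *)
Definition false_positives (f : {ffun J -> X}) : {set J} :=
  [set m | (m \notin w @: [set: I])%SET & f m \in C [ffun i => f (w i)]].

Lemma sum_extensions (R : numFieldType) (x : {ffun I -> X}) (D : {set X}) (S : {set J}) :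
  (0 < #|X|)%N -> S \subset (~: (w @: [set: I]))%SET ->
  \sum_(f : {ffun J -> X} | [ffun i => f (w i)] == x) [forall m in S, f m \in D]%:R
    = #|X|%:R ^+ (#|J| - #|I|) * (#|D|%:R / #|X|%:R) ^+ #|S| :> R.
Proof.
move=> X_gt0 SZ; have X_neq0 : #|X|%:R != 0 :> R by rewrite pnatr_eq0 -lt0n.
have S_le : (#|S| <= #|J| - #|I|)%N.
  by rewrite -card_setC_imset subset_leq_card.
transitivity ((#|D| ^ #|S| * #|X| ^ (#|J| - #|I| - #|S|))%:R : R).
  rewrite -(card_extensions x D SZ) -sum1dep_card natr_sum.
  by rewrite big_mkcondr; apply: eq_bigr => f _; case: ifP.
rewrite natrM !natrX -[in RHS](subnK S_le) exprD expr_div_n.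
by field; rewrite expf_neq0.
Qed.

(** Codebooks are grouped by the transmitted words [x], so that the minimum of the trivial bound and
    the union bound is taken for each [x], inside the mean. *)
Lemma false_positives_prob (R : realFieldType) (l : nat) : (0 < #|X|)%N ->
  (\sum_(f : {ffun J -> X}) (l <= #|false_positives f|)%N%:R) / #|X|%:R ^+ #|J| <=
  (\sum_(x : {ffun I -> X})
     Num.min 1 ('C(#|J| - #|I|, l)%:R * (#|C x|%:R / #|X|%:R) ^+ l))
  / #|X|%:R ^+ #|I| :> R.
Proof.
move=> X_gt0; have X_gt0' : 0 < #|X|%:R :> R by rewrite ltr0n.
have IJ : (#|I| <= #|J|)%N by exact: leq_card w_inj.
rewrite -{1}(subnK IJ) exprD invfM mulrA ler_pM2r ?invr_gt0 ?exprn_gt0//.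
rewrite ler_pdivrMr ?exprn_gt0// mulrC big_distrr /=.
rewrite (partition_big (fun f : {ffun J -> X} => [ffun i => f (w i)]) predT)//=.
apply: ler_sum => x _.
set Z := (w @: [set: I])%SET.
(* Trivial bound: the indicator is at most 1, and the extensions of [x] are counted with an empty
   [S]. *)
have b1 :
    \sum_(f : {ffun J -> X} | [ffun i => f (w i)] == x)
      (l <= #|false_positives f|)%N%:R
    <= #|X|%:R ^+ (#|J| - #|I|) :> R.
  have := sum_extensions R x finset.setT X_gt0 (finset.sub0set (~: Z)%SET).
  rewrite cards0 expr0 mulr1 => <-; apply: ler_sum => f _.
  by rewrite ler_nat; case: (l <= _)%N => //; rewrite lt0b; apply/forallP => m; rewrite inE.
(* Union bound: having at least [l] false positives means that some [l]-element set [S] of other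
   messages has all its words in [C x]. *)
have b2 :
    \sum_(f : {ffun J -> X} | [ffun i => f (w i)] == x)
      (l <= #|false_positives f|)%N%:R
    <= #|X|%:R ^+ (#|J| - #|I|) *
       ('C(#|J| - #|I|, l)%:R * (#|C x|%:R / #|X|%:R) ^+ l) :> R.
  apply: (@le_trans _ _ (\sum_(f : {ffun J -> X} | [ffun i => f (w i)] == x)
      \sum_(S : {set J} | (S \subset ~: Z)%SET && (#|S| == l))
        [forall m in S, f m \in C x]%:R)).
    apply: ler_sum => f /eqP fx; have [lfp|_] := leqP l; last by apply: sumr_ge0.
    have : (0 < #|[set S : {set J} | S \subset false_positives f & #|S| == l]%SET|)%N.
      by rewrite cards_draws bin_gt0.
    case/card_gt0P => S; rewrite inE => /andP[/fintype.subsetP Sfp Sl].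
    rewrite (bigD1 S)/= ?Sl ?andbT; last first.
      by apply/fintype.subsetP => m /Sfp; rewrite !inE => /andP[].
    have -> : [forall m in S, f m \in C x].
      by apply/forall_inP => m /Sfp; rewrite inE fx => /andP[].
    by rewrite lerDl sumr_ge0.
  rewrite exchange_big /=.
  under eq_bigr => S /andP[SZ /eqP Sl] do rewrite sum_extensions// Sl.
  rewrite sumr_const -[leLHS]mulr_natl mulrCA !mulrA le_eqVlt; apply/orP; left; apply/eqP.
  congr (_ * _%:R * _).
  rewrite -card_setC_imset -cards_draws.
  by apply: eq_card => S; rewrite !inE.
by rewrite minEle; case: ifP => _ //; rewrite mulr1.
Qed.
End FalsePositives.

(** * Averaging arguments and collision counting *)

Lemma exists_le_mean (R : realFieldType) (T : finType) (A : pred T) (F : T -> R)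
    (c : R) :
  (0 < #|A|)%N -> \sum_(x in A) F x <= #|A|%:R * c -> exists2 x, x \in A & F x <= c.
Proof.
move=> A_gt0 le_c; apply/exists_inP; apply: contraTT le_c => /exists_inPn Fc.
rewrite -ltNge mulr_natl -sumr_const; apply: ltr_sum => [|x /Fc]; last by rewrite ltNge.
by have /card_gt0P[x xA] := A_gt0; apply/hasP; exists x; rewrite ?mem_index_enum.
Qed.

(** A uniformly random [K]-subset of [L] misses a given element with probability
    [(#|L| - K) / #|L|]. Averaging the whole sum yields a single [B] that serves all [i]
    together. *)
Lemma exists_subset_avoiding_few (R : realFieldType) (J I : finType) (L : {set J})
    (K : nat) (P : pred I) (h : I -> J) : (K <= #|L|)%N -> (forall i, P i -> h i \in L) ->
  exists2 B : {set J}, (B \subset L) && (#|B| == K) &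
    \sum_(i | P i) (h i \notin B)%:R <= \sum_(i | P i) (#|L| - K)%:R / #|L|%:R :> R.
Proof.
move=> KL hL.
pose A := [pred B : {set J} | (B \subset L) && (#|B| == K)].
have cardA : #|A| = 'C(#|L|, K).
  by rewrite -cards_draws; apply: eq_card => B; rewrite !inE.
have [||B AB le_B] := @exists_le_mean R _ A (fun B => \sum_(i | P i) (h i \notin B)%:R)
   (\sum_(i | P i) (#|L| - K)%:R / #|L|%:R); last by exists B.
  by rewrite cardA bin_gt0.
rewrite exchange_big /= big_distrr /= le_eqVlt; apply/orP; left; apply/eqP.
apply: eq_bigr => i /hL hiL.
have L_gt0 : (0 < #|L|)%N by apply/card_gt0P; exists (h i).
rewrite mulrA; apply: (canRL (mulfK _)); first by rewrite pnatr_eq0 -lt0n.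
rewrite cardA -natrM (mulnC 'C(_, _)) -mul_bin_down mulnC natrM; congr (_ * _).
rewrite -natr_sum; congr (_%:R).
(* The subsets missing [h i] are the [K]-subsets of [L] with [h i] removed. *)
have -> : #|L|.-1 = #|(L :\ h i)%SET| by rewrite [in LHS](cardsD1 (h i)) hiL.
rewrite -cards_draws -sum1dep_card [RHS]big_mkcond /= [LHS]big_mkcond /=.
apply: eq_bigr => B _; rewrite inE subsetD1.
by case: (B \subset L) => //=; case: (_ == _); case: (_ \in _).
Qed.

(** Birthday bound: among the [M ^ K] assignments, at most a fraction ['C(K, 2) / M] is
    noninjective. Both sides carry an extra factor [M] to avoid the exponent [K - 1]. *)
Lemma expn_le_ffact (M K : nat) : (M ^ K.+1 <= M * M ^_ K + 'C(K, 2) * M ^ K)%N.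
Proof.
have le_expn k : (M ^_ k <= M ^ k)%N.
  by elim: k => // k IHk; rewrite ffactnSr expnSr leq_mul// leq_subr.
elim: K => [|K IHK]; first by rewrite expn1 ffactn0 muln1 leq_addr.
rewrite expnS; apply: (leq_trans (leq_mul (leqnn M) IHK)).
rewrite ffactnSr binS bin1 expnS.
(* This inequality survives the truncation of [M - K] when [K] exceeds [M]. *)
have /(leq_mul (leqnn (M * M ^_ K))) : (M <= M - K + K)%N by lia.
have /(leq_mul (leqnn (M * K))) := le_expn K.
lia.
Qed.

(** * Multinomial laws *)

(** For [n] independent uniform draws from [T], the counts of the values of [h] are multinomial. The
    draws [y] are grouped by the sequence [s] of their [h]-values, then the sequences by their
    counts. *)
Lemma sum_occ_multinomial (R : realType) (m n : nat) (T : finType) (h : T -> 'I_m)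
    (phi : ('I_m -> nat) -> R) :
  (\sum_(y : {ffun 'I_n -> T}) phi (occ (h \o y))) / #|T|%:R ^+ n =
  \sum_(a : {ffun 'I_m -> 'I_n.+1})
    multinomial_pmf n (fun k => #|[set t | h t == k]%SET|%:R / #|T|%:R) (fun k => a k)
    * phi (fun k => a k).
Proof.
pose N k := #|[set t | h t == k]%SET|.
have fib (s : {ffun 'I_n -> 'I_m}) :
    #|[pred y : {ffun 'I_n -> T} | [ffun i => h (y i)] == s]| = (\prod_k N k ^ occ s k)%N.
  transitivity (\prod_i N (s i))%N.
    transitivity (\prod_i #|[pred t | h t == s i]|)%N; last first.
      by apply: eq_bigr => i _; rewrite /N cardsE.
    rewrite -(card_pred_family (fun i => [pred t | h t == s i])) cardsE.
    apply: eq_card => y; rewrite [RHS]unfold_in [LHS]unfold_in.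
    apply/idP/forallP => [/eqP <- i|yP]; first by rewrite /= ffunE.
    by apply/eqP/ffunP => i; rewrite ffunE; apply/eqP/(yP i).
  rewrite /occ; under [RHS]eq_bigr do rewrite expn_sum.
  rewrite exchange_big; apply: eq_bigr => i _ /=.
  by rewrite (bigD1 (s i))//= eqxx expn1 big1 ?muln1// => k /negPf; rewrite eq_sym => ->.
rewrite (partition_big (fun y : {ffun 'I_n -> T} => [ffun i => h (y i)]) predT)//.
transitivity ((\sum_(s : {ffun 'I_n -> 'I_m}) phi (occ s) *
    (\prod_k N k ^ occ s k)%N%:R)
              / #|T|%:R ^+ n).
  congr (_ / _); apply: eq_bigr => s _.
  rewrite (eq_bigr (fun=> phi (occ s))) => [|y /eqP <-]; last first.
    by congr phi; apply/funext => k; apply: eq_bigr => i _; rewrite ffunE.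
  rewrite sumr_const -[LHS]mulr_natr; congr (_ * _%:R).
  by rewrite -fib; apply: eq_card => y; rewrite unfold_in.
have occ_lt (s : {ffun 'I_n -> 'I_m}) k : (occ s k < n.+1)%N.
  by rewrite ltnS -[leqRHS](sum_occ s) (bigD1 k)//= leq_addr.
(* By [occ_lt] counts are at most [n], so [inord] never falls back on its default. *)
rewrite (partition_big (fun s : {ffun 'I_n -> 'I_m} =>
  [ffun k => inord (occ s k) : 'I_n.+1]) predT)//.
rewrite big_distrl /=; apply: eq_bigr => a _.
have aE (s : {ffun 'I_n -> 'I_m}) :
    ([ffun k => inord (occ s k) : 'I_n.+1] == a) = [forall k, occ s k == a k].
  apply/eqP/forallP => [<- k|sa]; first by rewrite ffunE inordK.
  by apply/ffunP => k; apply: val_inj; rewrite ffunE /= inordK//; apply/eqP.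
rewrite (eq_bigl (fun s : {ffun 'I_n -> 'I_m} =>
  [forall k, occ s k == a k])); last exact: aE.
rewrite (eq_bigr (fun=> phi (fun k => a k) * (\prod_k N k ^ a k)%N%:R)); last first.
  move=> s /forallP sa; have -> : occ s = (fun k => a k) by apply/funext => k; apply/eqP.
  by [].
(* Vectors [a] not summing to [n] are the counts of no sequence, which matches the zero branch of
   the mass function. *)
rewrite sumr_const -[_ *+ #|_|]mulr_natr /multinomial_pmf;
case: eqP => [sum_a|sum_a]; last first.
  rewrite mul0r eq_card0 ?mulr0 ?mul0r// => s; rewrite !inE; apply/negP => /forallP sa.
  by apply: sum_a; rewrite -[RHS](sum_occ s); apply: eq_bigr => k _; apply/esym/eqP.
rewrite -(card_occ sum_a) natrM -natr_prod mulfK; last first.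
  by rewrite pnatr_eq0 -lt0n prodn_gt0// => k; rewrite fact_gt0.
have -> : \prod_(k < m) (#|[set t | h t == k]%SET|%:R / #|T|%:R) ^+ a k =
    (\prod_k N k ^ a k)%N%:R / #|T|%:R ^+ n :> R.
  under [LHS]eq_bigr do rewrite expr_div_n.
  rewrite prodf_div natr_prod; congr (_ / _); last by rewrite prodrXr sum_a.
  by apply: eq_bigr => k _; rewrite natrX.
by rewrite cardsE [RHS]mulrC [X in _ = _ * X]mulrCA !mulrA.
Qed.

(** * Events and expectations on a probability space *)

Lemma content_bigsetU_le (d : measure_display) (R : realFieldType) (T : ringOfSetsType d)
    (mu : {measure set T -> \bar R}) (I : Type) (s : seq I) (Q : pred I)
    (F : I -> set T) :
  (forall i, measurable (F i)) ->
  (mu (\big[setU/set0]_(i <- s | Q i) F i) <= \sum_(i <- s | Q i) mu (F i))%E.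
Proof.
move=> mF; elim: s => [|i s IHs]; first by rewrite !big_nil measure0.
rewrite !big_cons; case: ifP => // Qi.
apply: le_trans (leeD2l _ IHs); apply: measureU2 => //.
exact: bigsetU_measurable.
Qed.

(** The event is a finite union of sets [F w] on which all messages are fixed. Each has probability
    [M ^- K] by independence and uniformity, and subadditivity concludes. Error probabilities
    thereby reduce to counting. *)
Lemma independent_uniform_prob_le (R : realType) (K M : nat) (d : measure_display)
    (Omega : measurableType d) (P : probability Omega R) (W : 'I_K -> Omega -> 'I_M)
    (Q : pred {ffun 'I_K -> 'I_M}) (E : set Omega) :
  independent_uniform P W -> (forall t, E t <-> Q [ffun j => W j t]) ->
  (P E <= (#|Q|%:R / M%:R ^+ K)%:E)%E.
Proof.
case=> mW indepW unifW EQ.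
pose F (w : {ffun 'I_K -> 'I_M}) := [set t | forall j, [set w j]%classic (W j t)]%classic.
have mF w : measurable (F w).
  have -> : (F w = \bigcap_(j in [set: 'I_K]) (W j @^-1` [set w j]))%classic.
    by apply/seteqP; split=> t /= Ft j; [move=> _; exact: Ft|exact: Ft].
  by apply: fin_bigcap_measurable => // j _; exact: mW.
have -> : E = (\big[setU/set0]_(w in Q) F w)%classic.
  rewrite -(bigcup_pred Q).
  apply/seteqP; split=> t /=.
    by move=> /EQ Qt; exists [ffun j => W j t] => //= j; rewrite ffunE.
  move=> [w Qw Ft]; apply/EQ; rewrite (_ : [ffun _ => _] = w)//.
  by apply/ffunP => j; rewrite ffunE; exact: Ft.
apply: (le_trans (content_bigsetU_le _ _ _ mF)).
have PF w : P (F w) = ((M%:R ^+ K)^-1)%:E.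
  rewrite [LHS](indepW (fun j => [set w j]%classic)).
  under eq_bigr do rewrite unifW.
  by rewrite prodEFin prodr_const card_ord exprVn.
rewrite (eq_bigr (fun=> ((M%:R ^+ K)^-1)%:E)) => [|w _]; last exact: PF.
by rewrite sumEFin sumr_const mulr_natl.
Qed.

Section MultinomialExpectation.
Variables (R : realType) (m n : nat) (p : 'I_m -> R).
Variables (d : measure_display) (T : measurableType d) (P : probability T R).
Variable A : 'I_m -> {RV P >-> nat}.

Lemma measurable_counts_eq (a : 'I_m -> nat) :
  measurable [set t | forall k, A k t = a k]%classic.
Proof.
have -> : ([set t | forall k, A k t = a k] =
    \bigcap_(k in [set: 'I_m]) (A k @^-1` [set a k]))%classic.
  by apply/seteqP; split=> t /= At k; [move=> _; exact: At|exact: At].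
by apply: fin_bigcap_measurable => // k _; exact: measurable_funPTI.
Qed.

Lemma measurable_counts_comp (phi : ('I_m -> nat) -> R) :
  measurable_fun [set: T]%classic (fun t => phi (fun k => A k t)).
Proof.
move=> _ B mB; rewrite setTI.
(* Count vectors form a countable type, so the preimage of [B] is a countable union of level sets of
   the counts, enumerated through [unpickle]. *)
pose F (i : nat) := (if unpickle i is Some a then
  if `[< B (phi (fun k => (a : {ffun 'I_m -> nat}) k)) >]
  then [set t | forall k, A k t = a k] else set0 else set0)%classic.
rewrite (_ : (_ @^-1` B = \bigcup_i F i)%classic); last first.
  apply/seteqP; split=> t /= => [Bt|[i _]].
    exists (pickle [ffun k => A k t]) => //; rewrite /F pickleK.
    have -> : (fun k => [ffun k => A k t] k) = (fun k => A k t).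
      by apply/funext => k; rewrite ffunE.
    by rewrite asboolT// => k; rewrite ffunE.
  rewrite /F; case: unpickle => [a|]//; case: asboolP => // Ba At.
  by rewrite (_ : (fun k => A k t) = (fun k => a k))//; apply/funext.
apply: bigcupT_measurable => i; rewrite /F; case: unpickle => // a.
by case: ifP => // _; exact: measurable_counts_eq.
Qed.

(** The integral is restricted to the disjoint level sets with counts at most [n]; since [phi] is
    nonnegative, this can only decrease it. *)
Lemma multinomial_expectation_ge (phi : ('I_m -> nat) -> R) :
  multinomially_distributed n p A -> (forall a, 0 <= phi a) ->
  ((\sum_(a : {ffun 'I_m -> 'I_n.+1})
      multinomial_pmf n p (fun k => a k) * phi (fun k => a k))%:E
    <= 'E_P[fun t => phi (fun k => A k t)])%E.
Proof.
move=> Adistr phi0; rewrite expectation.unlock.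
pose F (a : {ffun 'I_m -> 'I_n.+1}) := [set t | forall k, A k t = a k]%classic.
have mF a : measurable (F a) by exact: measurable_counts_eq.
have /measurable_EFinP mphi := measurable_counts_comp phi.
apply: (@le_trans _ _ (\int[P]_(t in \big[setU/set0]_
    (a <- index_enum {ffun 'I_m -> 'I_n.+1}) F a)
   (phi (fun k => A k t))%:E)%E); last first.
  apply: ge0_subset_integral => //; [exact: bigsetU_measurable|].
  by move=> t _; rewrite lee_fin.
rewrite ge0_integral_bigsetU//; first last.
- by move=> t _; rewrite lee_fin.
- exact: measurable_funTS.
- move=> a b _ _ [t [Fa Fb]]; apply/ffunP => k; apply: val_inj => /=.
  by rewrite -[LHS](Fa k) -[RHS](Fb k).
- exact: index_enum_uniq.
rewrite -sumEFin; apply: lee_sum => a _.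
rewrite (eq_integral (cst (phi (fun k => a k))%:E)); last first.
  move=> t; rewrite inE => Fa /=; congr (phi _)%:E; exact/funext.
by rewrite integral_cst// [X in (_ * X)%E](Adistr (fun k => a k)) -EFinM mulrC.
Qed.
End MultinomialExpectation.

(** * The law of the output sizes *)

Lemma union_symbolsE (K q : nat) (c : 'I_K -> 'I_q) :
  union_symbols c = [set c j | j : 'I_K]%SET.
Proof.
apply/setP => s; apply/bigcupP/imsetP => [[j _ /set1P ->]|[j _ ->]]; first by exists j.
by exists j; rewrite ?inE.
Qed.

Definition compatible (K q n : nat) (x : {ffun 'I_K -> {ffun 'I_n -> 'I_q}}) :
    {set {ffun 'I_n -> 'I_q}} :=
  [set c : {ffun 'I_n -> 'I_q} | [forall i, c i \in union_symbols (fun j => x j i)]]%SET.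

Section SymbolCount.
Variables (K q : nat) (K_gt0 : (0 < K)%N).

Lemma symbol_count_subproof (c : 'I_K -> 'I_q) : (#|union_symbols c|.-1 < K)%N.
Proof. by have /andP[c_gt0 c_le] := union_symbolsP c K_gt0; rewrite prednK. Qed.

(* Shifted by one: the value [k] stands for [k.+1] distinct symbols. *)
Definition symbol_count (c : 'I_K -> 'I_q) : 'I_K := Ordinal (symbol_count_subproof c).

Lemma symbol_countE (c : 'I_K -> 'I_q) : (symbol_count c).+1 = #|union_symbols c|.
Proof. by have /andP[c_gt0 _] := union_symbolsP c K_gt0; rewrite /= prednK. Qed.

(** Users sending the same symbol form the blocks of a partition of the users, and the blocks carry
    distinct symbols: hence the Stirling number times a falling factorial. *)
Lemma symbol_count_prob (R : realType) (k : 'I_K) : (K <= q)%N ->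
  #|[set c : {ffun 'I_K -> 'I_q} | symbol_count c == k]%SET|%:R
    / #|{ffun 'I_K -> 'I_q}|%:R = out_size_prob R K q k.+1.
Proof.
move=> K_le_q; have k_lt_q : (k.+1 <= q)%N by exact: leq_trans K_le_q.
rewrite card_ffun !card_ord natrX /out_size_prob invfM mulrA; congr (_ / _).
have -> : #|[set c : {ffun 'I_K -> 'I_q} | symbol_count c == k]%SET|
    = (q ^_ k.+1 * stirling2 K k.+1)%N.
  rewrite -[in RHS](card_ord q) -card_ffun_card_imset; apply: eq_card => c.
  rewrite !inE -val_eqE /= -eqSS (symbol_countE c) union_symbolsE.
  suff -> : [set c j | j : 'I_K]%SET = (c @: [set: 'I_K])%SET by [].
  by apply/setP => s; apply/imsetP/imsetP => -[j _ ->]; exists j; rewrite ?inE.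
apply: (canRL (mulfK _)); first by rewrite pnatr_eq0 -lt0n fact_gt0.
by rewrite -natrM mulnAC ffact_fact.
Qed.

End SymbolCount.

(** The compatible words form a product over the channel uses, each contributing its output size
    over [q]; equal sizes are then collected. *)
Lemma card_compatible_ratio (R : numFieldType) (K q n : nat) (K_gt0 : (0 < K)%N)
    (x : {ffun 'I_K -> {ffun 'I_n -> 'I_q}}) :
  #|compatible x|%:R / #|{ffun 'I_n -> 'I_q}|%:R =
  \prod_(k < K) (k.+1%:R / q%:R) ^+ occ (fun i => symbol_count K_gt0 (fun j => x j i)) k :> R.
Proof.
rewrite (card_pred_family (fun i => mem (union_symbols (fun j => x j i)))).
rewrite card_ffun !card_ord natrX natr_prod.
rewrite -[in q%:R ^+ n](card_ord n) -prodr_const -prodf_div.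
under [RHS]eq_bigr do rewrite /occ -prodrXr.
rewrite exchange_big /=; apply: eq_bigr => i _.
rewrite (bigD1 (symbol_count K_gt0 (fun j => x j i)))//= eqxx expr1 big1 ?mulr1.
  by rewrite (symbol_countE K_gt0).
by move=> k /negPf; rewrite eq_sym => ->.
Qed.

(** Links the mean over [K] uniform words to the multinomial vector: read by channel use instead of
    by user, the words are [n] independent uniform columns, to which [sum_occ_multinomial]
    applies. *)
Lemma mean_compatible_le_expectation (R : realType) (K q n N l : nat)
    (d : measure_display) (T : measurableType d) (P : probability T R)
    (A : 'I_K -> {RV P >-> nat}) : (0 < K)%N -> (K <= q)%N ->
  multinomially_distributed n (fun k : 'I_K => out_size_prob R K q k.+1) A ->
  (((\sum_(x : {ffun 'I_K -> {ffun 'I_n -> 'I_q}})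
       Num.min 1 ('C(N, l)%:R * (#|compatible x|%:R / #|{ffun 'I_n -> 'I_q}|%:R) ^+ l))
    / #|{ffun 'I_n -> 'I_q}|%:R ^+ K)%:E <=
  'E_P[fun t => (Num.min 1
      ('C(N, l)%:R * \prod_(k < K) (k.+1%:R / q%:R) ^+ (A k t * l)%N))%R])%E.
Proof.
move=> K_gt0 K_le_q Adistr.
pose phi (a : 'I_K -> nat) : R :=
  Num.min 1 ('C(N, l)%:R * \prod_(k < K) (k.+1%:R / q%:R) ^+ (a k * l)%N).
have phi0 a : 0 <= phi a.
  rewrite le_min ler01 mulr_ge0//; apply: prodr_ge0 => k _.
  by rewrite exprn_ge0// divr_ge0.
apply: le_trans (multinomial_expectation_ge Adistr phi0).
rewrite lee_fin le_eqVlt; apply/orP; left; apply/eqP.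
rewrite (_ : (fun k : 'I_K => out_size_prob R K q k.+1) = fun k =>
    #|[set c : {ffun 'I_K -> 'I_q} | symbol_count K_gt0 c == k]%SET|%:R
    / #|{ffun 'I_K -> 'I_q}|%:R); last first.
  by apply/funext => k; rewrite symbol_count_prob.
rewrite -(sum_occ_multinomial n (fun c : {ffun 'I_K -> 'I_q} => symbol_count K_gt0 c) phi).
congr (_ / _); last by rewrite !card_ffun !card_ord !natrX -!exprM mulnC.
(* Transposition between the family of words and the family of columns. *)
pose tr (a b : nat) (x : {ffun 'I_a -> {ffun 'I_b -> 'I_q}}) :=
  [ffun i => [ffun j => x j i]].
have trK a b : cancel (@tr a b) (@tr b a).
  by move=> x; apply/ffunP => j; apply/ffunP => i; rewrite !ffunE.
rewrite (reindex (@tr n K)) /=; last by exists (@tr K n) => x _; exact: trK.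
apply: eq_bigr => y _; rewrite (card_compatible_ratio _ K_gt0) /phi.
rewrite -prodrXl; congr (Num.min _ (_ * _)); apply: eq_bigr => k _.
rewrite exprM; congr (_ ^+ _ ^+ _); apply: eq_bigr => i _; congr (nat_of_bool (_ == k)).
apply: val_inj => /=; congr #|pred_of_set _|.-1.
by rewrite !union_symbolsE; apply: eq_imset => j; rewrite !ffunE.
Qed.

(** * Decoders *)

Lemma noninjective_fraction (R : realFieldType) (K M : nat) : (0 < M)%N ->
  #|[set w : {ffun 'I_K -> 'I_M} | ~~ injectiveb w]%SET|%:R / M%:R ^+ K
    <= 'C(K, 2)%:R / M%:R :> R.
Proof.
move=> M_gt0; have M_gt0' : 0 < M%:R :> R by rewrite ltr0n.
rewrite ler_pdivrMr ?exprn_gt0// mulrAC ler_pdivlMr// -natrX -!natrM ler_nat.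
have -> : #|[set w : {ffun 'I_K -> 'I_M} | ~~ injectiveb w]%SET| = (M ^ K - M ^_ K)%N.
  rewrite -[in (M ^_ K)%N](card_ord M) -[X in (_ ^_ X)%N](card_ord K) -card_inj_ffuns.
  rewrite -[X in (X ^ K)%N](card_ord M) -[X in (_ ^ X)%N](card_ord K) -card_ffun.
  rewrite [LHS]cardsCs; congr (_ - #|pred_of_set _|)%N.
  by apply/setP => w; rewrite !inE negbK.
by rewrite mulnBl leq_subLR mulnC -expnS mulnC expn_le_ffact.
Qed.

Section RandomCode.
Variables (K q M n : nat) (K_gt0 : (0 < K)%N).
Notation word := {ffun 'I_n -> 'I_q}.
Notation users := {ffun 'I_K -> 'I_M}.
Implicit Types (f : {ffun 'I_M -> word}) (w : users).

Definition output f w : {ffun 'I_n -> out_symbol K q} :=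
  channel_output K_gt0 (fun j => f (w j)).

Definition candidates f (y : {ffun 'I_n -> out_symbol K q}) : {set 'I_M} :=
  [set m | [forall i, f m i \in val (y i)]]%SET.

(** Transmitted messages are always candidates, since their symbols enter every output set. *)
Lemma candidates_output f w : candidates f (output f w) =
  ((w @: [set: 'I_K]) :|: false_positives w (@compatible K q n) f)%SET.
Proof.
apply/setP => m; rewrite !inE; have [/imsetP[j _ ->]|_] /= := boolP (m \in _).
  apply/forallP => i; rewrite ffunE /=; apply/bigcupP; exists j => //.
  by rewrite inE.
apply: eq_forallb => i; rewrite ffunE /= !union_symbolsE.
by congr (_ \in pred_of_set _); apply: eq_imset => j; rewrite ffunE.
Qed.

Lemma card_candidates f w : injective w ->
  #|candidates f (output f w)| = (K + #|false_positives w (@compatible K q n) f|)%N.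
Proof.
move=> w_inj; rewrite candidates_output cardsU card_imset// cardsT card_ord.
rewrite [X in (_ - X)%N](_ : _ = 0%N) ?subn0//; apply/eqP; rewrite cards_eq0.
by apply/eqP/setP => m; rewrite !inE; case: (m \in _).
Qed.

(** The receiver does not see who sent what; this lets a decoder tuned to one user serve all of
    them. *)
Lemma output_perm f w (s : 'S_K) : output f [ffun j => w (s j)] = output f w.
Proof.
apply/ffunP => i; rewrite !ffunE; apply: val_inj => /=; rewrite !union_symbolsE.
apply/setP => c; apply/imsetP/imsetP => -[j _ ->].
  by exists (s j) => //; rewrite ffunE.
by have [t ts st] := injF_bij (@perm_inj _ s); exists (t j); rewrite // ffunE st.
Qed.

(** The loss [rho] depends only on the number of false positives. Exchanging the sums over [f] and
    [w] bounds the mean over codebooks, and some [f] does no worse than the mean. *)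
Lemma exists_code_le_mean (R : realFieldType) (rho : nat -> R) (beta : R) :
  (0 < q)%N -> (0 < M)%N ->
  (forall w, injective w ->
    (\sum_f rho #|false_positives w (@compatible K q n) f|) / #|word|%:R ^+ M <= beta) ->
  0 <= beta ->
  exists f, (\sum_(w : users | injectiveb w)
    rho #|false_positives w (@compatible K q n) f|) / M%:R ^+ K <= beta.
Proof.
move=> q_gt0 M_gt0 rho_le beta0.
have word_gt0 : 0 < #|word|%:R ^+ M :> R.
  by rewrite exprn_gt0// ltr0n card_ffun !card_ord expn_gt0 q_gt0.
have cardf : #|{: {ffun 'I_M -> word}}|%:R = #|word|%:R ^+ M :> R.
  by rewrite card_ffun card_ord natrX.
have [||f _ le_f] := @exists_le_mean R _ predT (fun f =>
  (\sum_(w : users | injectiveb w)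
    rho #|false_positives w (@compatible K q n) f|) / M%:R ^+ K) beta;
  last by exists f.
  by rewrite -(ltr0n R) cardf.
rewrite cardf -big_distrl /= exchange_big /=.
apply: (@le_trans _ _ ((\sum_(w : users | injectiveb w) #|word|%:R ^+ M * beta) / M%:R ^+ K)).
  rewrite ler_wpM2r ?invr_ge0 ?exprn_ge0//; apply: ler_sum => w /injectiveP w_inj.
  by rewrite -ler_pdivrMl// mulrC rho_le.
(* The injective assignments are a fraction at most 1 of all [M ^ K]; nonnegativity of [beta] lets
   that fraction be dropped. *)
rewrite sumr_const -[_ *+ #|_|]mulr_natr -mulrA ler_piMr ?mulr_ge0 ?(ltW word_gt0)//.
rewrite ler_pdivrMr ?exprn_gt0 ?ltr0n// mul1r -natrX ler_nat.
by rewrite -[X in (_ <= X ^ _)%N]card_ord -[X in (_ <= _ ^ X)%N]card_ord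
  -card_ffun max_card.
Qed.

(** For each output [y], the decoder picks a [K]-subset of the candidates that misses the message of
    [j0] for few of the assignments producing [y]. With [N] false positives there are [K + N]
    candidates, whence the ratio [N / (K + N)]. *)
Lemma exists_list_decoder (R : realFieldType) f (j0 : 'I_K) : (K <= M)%N ->
  exists g : decoder K q M n,
    \sum_(w : users | injectiveb w) (w j0 \notin val (g (output f w)))%:R <=
    \sum_(w : users | injectiveb w)
      (#|false_positives w (@compatible K q n) f|)%:R
       / (K + #|false_positives w (@compatible K q n) f|)%:R :> R.
Proof.
move=> K_le_M.
have /boolp.choice[g gP] : forall y, exists B : message_subset M K,
    \sum_(w : users | injectiveb w && (output f w == y)) (w j0 \notin val B)%:R <=
    \sum_(w : users | injectiveb w && (output f w == y))
      (#|false_positives w (@compatible K q n) f|)%:R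
       / (K + #|false_positives w (@compatible K q n) f|)%:R :> R.
  (* With fewer than [K] candidates, [y] arises from no injective assignment: both sums are empty
     and any [K]-subset will do. *)
  move=> y; have [K_le|lt_K] := leqP K #|candidates f y|; last first.
    have : (0 < #|[set B : {set 'I_M} | #|B| == K]%SET|)%N.
      by rewrite card_draws card_ord bin_gt0.
    case/card_gt0P => B; rewrite inE => BK; exists (exist _ B BK).
    rewrite !big_pred0// => w; apply/negP => /andP[/injectiveP w_inj /eqP wy];
      by move: lt_K; rewrite -wy card_candidates// ltnNge leq_addr.
  have [|B /andP[BL BK] le_B] := @exists_subset_avoiding_few R _ _ (candidates f y) K
    (fun w : users => injectiveb w && (output f w == y)) (fun w => w j0) K_le.
    move=> w /andP[_ /eqP <-]; rewrite candidates_output !inE.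
    by rewrite imset_f ?inE.
  exists (exist _ B BK); apply: le_trans le_B _; rewrite le_eqVlt; apply/orP; left; apply/eqP.
  apply: eq_bigr => w /andP[/injectiveP w_inj /eqP <-].
  by rewrite card_candidates// addKn.
exists g; rewrite (partition_big (output f) predT)// [leRHS](partition_big (output f) predT)//.
apply: ler_sum => y _; apply: le_trans (gP y).
by apply: ler_sum => w /andP[_ /eqP ->].
Qed.

(** Without false positives the candidates are exactly the [K] transmitted messages, so the decoder
    returns them; [B0] is its value when their number is not [K]. *)
Lemma exists_exact_decoder f : (K <= M)%N ->
  exists g : decoder K q M n, forall w : users, injective w ->
    false_positives w (@compatible K q n) f = finset.set0 ->
    val (g (output f w)) = (w @: [set: 'I_K])%SET.
Proof.
move=> K_le_M.
have [B0 B0K] : exists B : {set 'I_M}, #|B| == K.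
  have : (0 < #|[set B : {set 'I_M} | #|B| == K]%SET|)%N.
    by rewrite card_draws card_ord bin_gt0.
  by case/card_gt0P => B; rewrite inE => BK; exists B.
exists (fun y => insubd (exist _ B0 B0K : message_subset M K) (candidates f y)).
move=> w w_inj fp0; rewrite insubdK; first by rewrite candidates_output fp0 finset.setU0.
by apply/eqP; rewrite card_candidates// fp0 cards0 addn0.
Qed.

End RandomCode.

(** Noninjective assignments all count as errors, at the collision cost; on the injective ones [Q]
    is dominated by [loss]. *)
Lemma error_fraction_le (R : realFieldType) (K M : nat)
    (Q loss : pred {ffun 'I_K -> 'I_M}) :
  (0 < M)%N -> (forall w : {ffun 'I_K -> 'I_M}, injective w -> Q w -> loss w) ->
  #|Q|%:R / M%:R ^+ K <= 'C(K, 2)%:R / M%:R +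
    (\sum_(w : {ffun 'I_K -> 'I_M} | injectiveb w) (loss w)%:R) / M%:R ^+ K :> R.
Proof.
move=> M_gt0 Q_loss; apply: le_trans (lerD (noninjective_fraction R K M_gt0) (lexx _)).
rewrite -mulrDl ler_wpM2r ?invr_ge0 ?exprn_ge0// -natr_sum -natrD ler_nat.
rewrite -sum1dep_card -sum1_card big_mkcond [X in (X + _)%N]big_mkcond.
rewrite [X in (_ + X)%N]big_mkcond -big_split /=; apply: leq_sum => w _.
have [/injectiveP w_inj|//] := boolP (injectiveb w); last by case: ifP.
by case: ifP => // /(Q_loss w w_inj) ->.
Qed.

(** If [0 < N < K], the term [l = N] alone is the left-hand side; if [N] is at least [K], the ratio
    is at most 1 and the last indicator pays for it. Only tail events then remain to be bounded. *)
Lemma false_positive_ratio_le (R : realFieldType) (K N : nat) : (0 < K)%N ->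
  N%:R / (K + N)%:R <=
  \sum_(1 <= l < K) l%:R / (K + l)%:R * (l <= N)%N%:R + (K <= N)%N%:R :> R.
Proof.
move=> K_gt0; have ratio_ge0 l : 0 <= l%:R / (K + l)%:R :> R by rewrite divr_ge0.
have sum_ge0 : 0 <= \sum_(1 <= l < K) l%:R / (K + l)%:R * (l <= N)%N%:R :> R.
  by apply: sumr_ge0 => l _; rewrite mulr_ge0.
have [K_le|N_lt] := leqP K N.
  apply: ler_wpDl => //.
  by rewrite ler_pdivrMr ?mul1r ?ler_nat ?leq_addl// ltr0n addn_gt0 K_gt0.
rewrite addr0; have [N0|N_gt0] := posnP N; first by rewrite {1}N0 mul0r.
rewrite (bigD1_seq N) ?mem_index_iota ?N_gt0 ?N_lt ?iota_uniq//= leqnn mulr1 lerDl.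
by apply: sumr_ge0 => l _; rewrite mulr_ge0.
Qed.

(** * Existence of codes for both error criteria *)

Section Existence.
Variables (R : realType) (K q M n : nat) (K_gt0 : (0 < K)%N).
Hypotheses (q_gt0 : (0 < q)%N) (M_gt0 : (0 < M)%N) (K_le_M : (K <= M)%N).

(** The truncated union bound averaged over [K] independent uniform words, before its comparison
    with a multinomial expectation. *)
Definition false_positives_bound (l : nat) : R :=
  (\sum_(x : {ffun 'I_K -> {ffun 'I_n -> 'I_q}})
     Num.min 1 ('C(M - K, l)%:R * (#|compatible x|%:R / #|{ffun 'I_n -> 'I_q}|%:R) ^+ l))
  / #|{ffun 'I_n -> 'I_q}|%:R ^+ K.

Lemma false_positives_bound_ge0 l : 0 <= false_positives_bound l.
Proof.
rewrite divr_ge0 ?exprn_ge0//; apply: sumr_ge0 => x _.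
by rewrite le_min ler01 mulr_ge0// exprn_ge0// divr_ge0.
Qed.

Lemma false_positives_mean_le (w : {ffun 'I_K -> 'I_M}) l : injective w ->
  (\sum_(f : {ffun 'I_M -> {ffun 'I_n -> 'I_q}})
    (l <= #|false_positives w (@compatible K q n) f|)%N%:R)
    / #|{ffun 'I_n -> 'I_q}|%:R ^+ M <= false_positives_bound l.
Proof.
move=> w_inj; have := @false_positives_prob _ _ _ w (@compatible K q n) w_inj R l.
rewrite !card_ord; apply.
by rewrite card_ffun !card_ord expn_gt0 q_gt0.
Qed.

Lemma per_user_code_exists : exists (f : encoder q M n) (g : decoder K q M n),
  per_user_code K_gt0 ('C(K, 2)%:R / M%:R +
    (\sum_(1 <= l < K) l%:R / (K + l)%:R * false_positives_bound l
     + false_positives_bound K)) f g.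
Proof.
set beta := _ + false_positives_bound K.
have ratio_ge0 l : 0 <= l%:R / (K + l)%:R :> R by rewrite divr_ge0.
have [||f le_f] := @exists_code_le_mean K q M n R
  (fun N => N%:R / (K + N)%:R) beta q_gt0 M_gt0.
- move=> w w_inj.
  apply: (@le_trans _ _ ((\sum_(f : {ffun 'I_M -> {ffun 'I_n -> 'I_q}})
    (\sum_(1 <= l < K) l%:R / (K + l)%:R *
       (l <= #|false_positives w (@compatible K q n) f|)%N%:R +
     (K <= #|false_positives w (@compatible K q n) f|)%N%:R))
    / #|{ffun 'I_n -> 'I_q}|%:R ^+ M)).
    rewrite ler_wpM2r ?invr_ge0 ?exprn_ge0//; apply: ler_sum => f _.
    exact: false_positive_ratio_le.
  rewrite big_split/= mulrDl exchange_big/= lerD ?false_positives_mean_le//.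
  rewrite big_distrl /=; apply: ler_sum => l _.
  rewrite -big_distrr /= -[leLHS]mulrA; apply: ler_wpM2l => //.
  exact: false_positives_mean_le.
- rewrite addr_ge0 ?false_positives_bound_ge0//; apply: sumr_ge0 => l _.
  by rewrite mulr_ge0 ?false_positives_bound_ge0.
pose j0 := Ordinal K_gt0.
have [g le_g] := exists_list_decoder K_gt0 R f j0 K_le_M.
exists f, g => d Omega P W indepW j.
pose loss (i : 'I_K) (w : {ffun 'I_K -> 'I_M}) := w i \notin val (g (output K_gt0 f w)).
(* The error event as a predicate on assignments; its collision part is void on injective ones. *)
pose Q (w : {ffun 'I_K -> 'I_M}) := loss j w || [exists i, (i != j) && (w j == w i)].
apply: le_trans (independent_uniform_prob_le (Q := Q) indepW _) _.
  move=> t; rewrite /Q /loss ffunE.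
  have -> : output K_gt0 f [ffun i => W i t] = channel_output K_gt0 (fun i => f (W i t)).
    by rewrite /output; congr channel_output; apply/funext => i; rewrite ffunE.
  split=> [[/= ->//|[i ij Wij]]|/orP[Wj|/existsP[i /andP[ij]]]].
  - by apply/orP; right; apply/existsP; exists i; rewrite ij ffunE Wij /=.
  - by left.
  - by rewrite !ffunE => /eqP Wij; right; exists i.
rewrite lee_fin; apply: le_trans (error_fraction_le R (loss := loss j) M_gt0 _) _.
  move=> w w_inj /orP[//|/existsP[i /andP[ij /eqP/w_inj ji]]].
  by rewrite ji eqxx in ij.
rewrite lerD2l; apply: le_trans le_f.
rewrite ler_wpM2r ?invr_ge0 ?exprn_ge0//; apply: le_trans le_g.
(* [g] is tuned to [j0]; exchanging the messages of [j] and [j0] leaves the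
   output unchanged. *)
pose h (w : {ffun 'I_K -> 'I_M}) : {ffun 'I_K -> 'I_M} :=
  [ffun i => w (tperm j j0 i)].
have hK : involutive h by move=> w; apply/ffunP => i; rewrite !ffunE tpermK.
rewrite (reindex h) /=; last by exists h => w _; exact: hK.
have h_inj (w : {ffun 'I_K -> 'I_M}) : injectiveb w -> injectiveb (h w).
  move=> /injectiveP w_inj; apply/injectiveP => a b; rewrite !ffunE.
  by move=> /w_inj/perm_inj.
rewrite (eq_bigl (fun w : {ffun 'I_K -> 'I_M} => injectiveb w)); last first.
  by move=> w; apply/idP/idP => /h_inj //; rewrite hK.
by apply: ler_sum => w _; rewrite /loss output_perm ffunE tpermL.
Qed.

(** The loss is the indicator of at least one false positive, so only the bound for [l = 1]
    enters. *)
Lemma joint_code_exists : exists (f : encoder q M n) (g : decoder K q M n),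
  joint_code K_gt0 ('C(K, 2)%:R / M%:R + false_positives_bound 1) f g.
Proof.
have [||f le_f] := @exists_code_le_mean K q M n R
  (fun N => (1 <= N)%N%:R) (false_positives_bound 1)
  q_gt0 M_gt0.
- by move=> w w_inj; exact: false_positives_mean_le.
- exact: false_positives_bound_ge0.
have [g gP] := exists_exact_decoder K_gt0 f K_le_M.
exists f, g => d Omega P W indepW.
pose Q (w : {ffun 'I_K -> 'I_M}) :=
  ((w @: [set: 'I_K])%SET != val (g (output K_gt0 f w))) || ~~ injectiveb w.
apply: le_trans (independent_uniform_prob_le (Q := Q) indepW _) _.
  move=> t; rewrite /Q.
  have -> : output K_gt0 f [ffun i => W i t] = channel_output K_gt0 (fun i => f (W i t)).
    by rewrite /output; congr channel_output; apply/funext => i; rewrite ffunE.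
  have -> : ([ffun i => W i t] @: [set: 'I_K])%SET = [set W j t | j : 'I_K]%SET.
    by apply/setP => m; apply/imsetP/imsetP => -[i _ ->]; exists i; rewrite ?inE ?ffunE.
  split=> [[/= /eqP ->//|[i [i' [ii' Wii']]]]|/orP[/eqP Wg|]].
  - apply/orP; right; apply: contra ii' => /injectiveP W_inj; apply/eqP/W_inj.
    by rewrite !ffunE.
  - by left.
  - move=> /injectivePn[i [i' ii']]; rewrite !ffunE => Wii'; right.
    by exists i, i'.
rewrite lee_fin; apply: le_trans (error_fraction_le R
  (loss := fun w => (0 < #|false_positives w (@compatible K q n) f|)%N) M_gt0 _) _.
  move=> w w_inj /orP[|/negP nw_inj]; last by case: nw_inj; apply/injectiveP.
  rewrite lt0n; apply: contra; rewrite cards_eq0 => /eqP fp0.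
  by rewrite (gP w w_inj fp0).
by rewrite lerD2l.
Qed.
End Existence.

Local Open Scope classical_set_scope.
Local Open Scope ring_scope.

(* k : 'I_K is numbered from 0: A k is the count of the outcome k.+1. *)
Theorem theorem1 (R : realType) (K q M n : nat)
    (K_gt0 : (0 < K)%N) (q_gt0 : (0 < q)%N) (M_gt0 : (0 < M)%N)
    (n_gt0 : (0 < n)%N) (K_lt_q : (K < q)%N) (K_le_M : (K <= M)%N)
    (d : measure_display) (T : measurableType d) (P : probability T R)
    (A : 'I_K -> {RV P >-> nat})
    (A_multinomial :
      multinomially_distributed n (fun k : 'I_K => out_size_prob R K q k.+1) A) :
  (exists (f : encoder q M n) (g : decoder K q M n) (eps : R),
     per_user_code K_gt0 eps f g /\
     (eps%:E <=
       \sum_(1 <= l < K) ((l%:R / (K + l)%:R)%R%:E *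
         'E_P[fun t => (Num.min 1
           ('C(M - K, l)%:R *
            \prod_(k < K) (k.+1%:R / q%:R) ^+ (A k t * l)%N))%R])
       + 'E_P[fun t => (Num.min 1
           ('C(M - K, K)%:R *
            \prod_(k < K) (k.+1%:R / q%:R) ^+ (A k t * K)%N))%R]
       + ('C(K, 2)%:R / M%:R)%R%:E)%E)
  /\
  (exists (f : encoder q M n) (g : decoder K q M n) (eps : R),
     joint_code K_gt0 eps f g /\
     (eps%:E <=
       ('C(K, 2)%:R / M%:R)%R%:E
       + 'E_P[fun t => (Num.min 1
           ((M - K)%:R * \prod_(k < K) (k.+1%:R / q%:R) ^+ A k t))%R])%E).
Proof.
have K_le_q := ltnW K_lt_q.
have bound l : ((false_positives_bound R K q M n l)%:E <= 'E_P[fun t => (Num.min 1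
    ('C(M - K, l)%:R * \prod_(k < K) (k.+1%:R / q%:R) ^+ (A k t * l)%N))%R])%E.
  exact: mean_compatible_le_expectation.
split.
  have [f [g fg]] := per_user_code_exists R n K_gt0 q_gt0 M_gt0 K_le_M.
  exists f, g; eexists; split; first exact: fg.
  rewrite addrC !EFinD; apply: leeD => //; apply: leeD => //.
  rewrite -sumEFin; apply: lee_sum => l _; rewrite EFinM.
  apply: lee_wpmul2l; last exact: bound.
  by rewrite lee_fin divr_ge0.
have [f [g fg]] := joint_code_exists R n K_gt0 q_gt0 M_gt0 K_le_M.
exists f, g; eexists; split; first exact: fg.
rewrite EFinD; apply: leeD => //; apply: le_trans (bound 1%N) _.
(* For [l = 1] the binomial coefficient is [M - K] and the factor in the exponents disappears. *)
rewrite le_eqVlt; apply/orP; left; apply/eqP; congr expectation.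
apply/funext => t; rewrite bin1; congr (Num.min _ (_ * _)).
by apply: eq_bigr => k _; rewrite muln1.
Qed.
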